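(* Let $1/2<\alpha<1$ and let $d_\alpha$ be the metric on $[0,\infty)$ given by $d_\alpha(x,y)=\left((x-y)^2+(x^\alpha-y^\alpha)^2\right)^{1/2}$. Then $([0,\infty),d_\alpha)$ is not Gromov hyperbolic.
   Context: A metric space $(X,d)$ is Gromov hyperbolic if there exists $\delta\geq 0$ such that for all $x,y,z,w\in X$, $d(x,y)+d(z,w)\leq\max\{d(x,z)+d(y,w),\ d(y,z)+d(x,w)\}+2\delta$. *)

(* Defs.v *)
From HB Require Import structures.
From mathcomp Require Import all_boot all_order all_algebra.
From mathcomp Require Import ring lra.
From mathcomp Require Import all_classical all_reals all_analysis.

Set Implicit Arguments.
Unset Strict Implicit.
Unset Printing Implicit Defensive.

Import Order.TTheory GRing.Theory Num.Theory.

Local Open Scope ring_scope.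

Definition gromov_hyperbolic (R : realType) (X : metricType R) : Prop :=
  exists2 delta : R, 0 <= delta &
    forall x y z w : X,
      mdist x y + mdist z w
        <= Num.max (mdist x z + mdist y w) (mdist y z + mdist x w) + 2 * delta.

(* The carrier does not depend on alpha: the parameter only selects the metric
   structure attached to the type. *)
Definition half_line (R : realType) (alpha : R) : Type :=
  {x : R | x \in `[0, +oo[}.

HB.instance Definition _ (R : realType) (alpha : R) := Choice.on (half_line alpha).

Definition half_line_dist (R : realType) (alpha : R) (x y : half_line alpha) : R :=
  Num.sqrt ((sval x - sval y) ^+ 2 + (sval x `^ alpha - sval y `^ alpha) ^+ 2).

Section half_line_metric.
Context (R : realType) (alpha : R).

Let dist := @half_line_dist R alpha.

Let dist_xx x : dist x x = 0.
Proof. by rewrite /dist /half_line_dist !subrr expr0n /= addr0 sqrtr0. Qed.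

Let dist_eq0 x y : dist x y = 0 -> x = y.
Proof.
move=> /eqP; rewrite sqrtr_eq0 => h; apply: val_inj; apply/eqP.
rewrite -subr_eq0 -sqrf_eq0 eq_le sqr_ge0 andbT.
by apply: le_trans h; rewrite lerDl sqr_ge0.
Qed.

Let dist_sym x y : dist x y = dist y x.
Proof. by rewrite /dist /half_line_dist -sqrrN opprB -[X in _ + X]sqrrN opprB. Qed.

Let sqrt_triangle (a b c d : R) :
  Num.sqrt ((a + c) ^+ 2 + (b + d) ^+ 2)
    <= Num.sqrt (a ^+ 2 + b ^+ 2) + Num.sqrt (c ^+ 2 + d ^+ 2).
Proof.
have nn (u v : R) : 0 <= u ^+ 2 + v ^+ 2 by rewrite addr_ge0 ?sqr_ge0.
have CS : a * c + b * d <= Num.sqrt (a ^+ 2 + b ^+ 2) * Num.sqrt (c ^+ 2 + d ^+ 2).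
  rewrite -sqrtrM // (le_trans (ler_norm _)) // -sqrtr_sqr ler_wsqrtr //.
  rewrite -subr_ge0 [leRHS](_ : _ = (a * d - b * c) ^+ 2) ?sqr_ge0 //; ring.
rewrite -(ler_pXn2r (ltn0Sn 1)) ?nnegrE ?addr_ge0 ?sqrtr_ge0 //.
rewrite [leRHS]sqrrD !sqr_sqrtr //; lra.
Qed.

Let dist_triangle y x z : dist x z <= dist x y + dist y z.
Proof.
apply: le_trans (sqrt_triangle _ _ _ _).
by rewrite !addrA !subrK.
Qed.

HB.instance Definition _ := isMetric.Build R (half_line alpha)
  dist_xx dist_eq0 dist_sym dist_triangle.

End half_line_metric.

Lemma half_line_mdistE (R : realType) (alpha : R) (x y : half_line alpha) :
  mdist x y =
  Num.sqrt ((sval x - sval y) ^+ 2 + (sval x `^ alpha - sval y `^ alpha) ^+ 2).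
Proof. by []. Qed.

(* Main.v *)
Require Import Defs.
From mathcomp Require Import all_boot all_order all_algebra.
From mathcomp Require Import ring lra.
From mathcomp Require Import all_classical all_reals all_analysis.

(** The space is the graph of [x `^ alpha] with the Euclidean distance of the
    plane.  The distance [d(x, y)] is the horizontal length [|x - y|] plus a
    correction close to [(x `^ alpha - y `^ alpha)^2 / (2 |x - y|)], which is
    homogeneous of degree [2 alpha - 1 > 0], hence unbounded under dilation.

    For points [a < b < c < e] of a line, the two larger sums in the four-point
    condition, [d(a,c) + d(b,e)] and [d(a,e) + d(b,c)], are equal.  Here the
    lengths cancel and the corrections remain.  Take the points
    [0, t, 4t, 16t]: with [y = 4 `^ alpha] their ordinates are
    [0, T, yT, y^2 T], where [T = t `^ alpha], and the difference of the two
    sums is, to first order, [T^2 / (2t)] times a polynomial in [y] that factors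
    as [(y - 4)^2] times a factor positive for [y > 1] ([gap_gt0]).
    Since [alpha < 1] gives [y < 4], the difference grows like
    [t `^ (2 alpha - 1)].  The error in the first-order expansion is smaller
    by a factor [(T / t)^2 = t `^ (2 alpha - 2)], which tends to [0], and the
    third sum is smaller by about [6t] ([four_point_excess]).  So no [delta]
    works for all [t]. *)

Set Implicit Arguments.
Unset Strict Implicit.
Unset Printing Implicit Defensive.

Import Order.TTheory GRing.Theory Num.Theory.

Local Open Scope ring_scope.

Section Hypotenuse.
Variable R : realType.
Implicit Types h v : R.

Lemma ler_hypot h v : 0 <= h -> h <= Num.sqrt (h ^+ 2 + v ^+ 2).
Proof.
move=> h0; rewrite -[leLHS]ger0_norm // -sqrtr_sqr ler_wsqrtr //.
by rewrite lerDl sqr_ge0.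
Qed.

(** Completing the square: [h^2 + v^2 <= (h + v^2 / (2h))^2]. *)
Lemma hypot_ler h v : 0 < h ->
  Num.sqrt (h ^+ 2 + v ^+ 2) <= h + v ^+ 2 / (2 * h).
Proof.
move=> h0; have x0 : 0 <= v ^+ 2 / (2 * h) by rewrite divr_ge0 ?sqr_ge0 //; lra.
rewrite -(ler_pXn2r (ltn0Sn 1)) ?nnegrE ?sqrtr_ge0 //; last lra.
rewrite sqr_sqrtr ?addr_ge0 ?sqr_ge0 // -subr_ge0.
rewrite [leRHS](_ : _ = (v ^+ 2 / (2 * h)) ^+ 2) ?sqr_ge0 //; field; lra.
Qed.

(** The hypotenuse [d] and [x = v^2 / (2h)] satisfy
    [d = h + x - (d - h)^2 / (2h)] exactly, and [0 <= d - h <= x] by the two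
    bounds above. *)
Lemma ler_hypot_second_order h v : 0 < h ->
  h + v ^+ 2 / (2 * h) - (v ^+ 2 / (2 * h)) ^+ 2 / (2 * h)
    <= Num.sqrt (h ^+ 2 + v ^+ 2).
Proof.
move=> h0; have := hypot_ler v h0; have := ler_hypot v (ltW h0).
have : Num.sqrt (h ^+ 2 + v ^+ 2) ^+ 2 = h ^+ 2 + v ^+ 2.
  by rewrite sqr_sqrtr // addr_ge0 ?sqr_ge0.
set d := Num.sqrt _; set x := v ^+ 2 / _ => dE hd dx.
have vE : v ^+ 2 = 2 * h * x by rewrite /x; field; lra.
have dE' : d = h + x - (d - h) ^+ 2 / (2 * h).
  have -> : (d - h) ^+ 2 = 2 * h * (h + x - d).
    by rewrite sqrrB dE vE; ring.
  by field; lra.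
rewrite [leRHS]dE' lerD2l lerN2 ler_pM2r ?invr_gt0; last lra.
by rewrite ler_pXn2r ?nnegrE //; lra.
Qed.

End Hypotenuse.

Section FourPoints.
Variable R : realType.
Implicit Types t T y : R.

(** Twice the first-order difference of the two large sums for the points
    [0, t, 4t, 16t], in units of [T^2 / t]. *)
Definition gap y : R :=
  y ^+ 2 / 4 + (y ^+ 2 - 1) ^+ 2 / 15 - (y ^+ 2) ^+ 2 / 16 - (y - 1) ^+ 2 / 3.

(** The gap factors with a double root at [y = 4], the value for [alpha = 1],
    where the four points are collinear. *)
Lemma gap_gt0 y : 1 < y < 4 -> 0 < gap y.
Proof.
move=> /andP[y1 y4].
rewrite [ltRHS](_ : _ = (4 - y) ^+ 2 * (y ^+ 2 / 16 + y / 2 - 1 / 4) / 15).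
  rewrite divr_gt0 // mulr_gt0 ?exprn_gt0 //; first lra.
  by have := sqr_ge0 y; lra.
by rewrite /gap; field.
Qed.

Lemma gap_le4 y : 1 < y < 4 -> gap y <= 4.
Proof.
move=> /andP[y1 y4]; rewrite /gap.
have z1 : 1 <= y ^+ 2 <= 16 by apply/andP; split; nra.
have : (y - 1) ^+ 2 >= 0 by rewrite sqr_ge0.
move: z1; set z := y ^+ 2 => /andP[z1 z16]; nra.
Qed.

(** The horizontal lengths give [19t] for the sum on the right-hand side, and
    [13t] and [19t] for the other two.  In the first inequality the margin [6t]
    is reduced only by the first-order corrections of the smallest sum, at most
    [A / 2] and [6 * A].  In the second the lengths cancel and the corrections
    decide; the constant 3 bounds the sum of the second-order errors
    [y^4 / 512] and [(y^2 - 1)^4 / 27000] for [y < 4]. *)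
Lemma four_point_excess t T y : 0 < t -> 1 < y < 4 ->
  let dist a b c e := Num.sqrt ((a - c) ^+ 2 + (b - e) ^+ 2) in
  let A := T ^+ 2 / t in
  dist 0 0 t T + dist (4 * t) (y * T) (16 * t) (y ^+ 2 * T) + 6 * t - 7 * A
    <= dist 0 0 (4 * t) (y * T) + dist t T (16 * t) (y ^+ 2 * T) /\
  dist (4 * t) (y * T) t T + dist 0 0 (16 * t) (y ^+ 2 * T)
    + A * (gap y / 2 - 3 * (A / t))
    <= dist 0 0 (4 * t) (y * T) + dist t T (16 * t) (y ^+ 2 * T).
Proof.
move=> t0 y14 dist A; have /andP[y1 y4] := y14.
have distE a b c e h v : h = c - a -> v = e - b ->
    dist a b c e = Num.sqrt (h ^+ 2 + v ^+ 2).
  by move=> -> ->; rewrite /dist -sqrrN opprB -[X in _ + X]sqrrN opprB.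
have distC a b c e : dist a b c e = dist c e a b.
  by rewrite /dist -sqrrN opprB -[X in _ + X]sqrrN opprB.
rewrite (distC (4 * t) (y * T) t T).
rewrite (distE 0 0 t T t T) ?subr0 //.
rewrite (distE (4 * t) _ _ _ (12 * t) ((y ^+ 2 - y) * T)); [|ring|ring].
rewrite (distE 0 0 (4 * t) (y * T) (4 * t) (y * T)) ?subr0 //.
rewrite (distE t T (16 * t) _ (15 * t) ((y ^+ 2 - 1) * T)); [|ring|ring].
rewrite (distE t T (4 * t) _ (3 * t) ((y - 1) * T)); [|ring|ring].
rewrite (distE 0 0 (16 * t) _ (16 * t) (y ^+ 2 * T)) ?subr0 //.
have kt k : 0 < k -> 0 < k * t by move=> k0; rewrite mulr_gt0.
have quoE k v : 0 < k -> (v * T) ^+ 2 / (2 * (k * t)) = v ^+ 2 / (2 * k) * A.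
  by move=> k0; rewrite /A; field; rewrite !gt_eqF.
have A0 : 0 <= A by rewrite divr_ge0 ?sqr_ge0 // ltW.
have z1 : 1 <= y ^+ 2 <= 16 by apply/andP; split; nra.
split.
- have le1 := hypot_ler T t0.
  have le2 := hypot_ler ((y ^+ 2 - y) * T) (kt 12 ltac:(lra)).
  have ge1 := ler_hypot (y * T) (ltW (kt 4 ltac:(lra))).
  have ge2 := ler_hypot ((y ^+ 2 - 1) * T) (ltW (kt 15 ltac:(lra))).
  have le1' : T ^+ 2 / (2 * t) = A / 2 by rewrite /A; field; rewrite gt_eqF.
  rewrite le1' in le1; rewrite quoE in le2; last lra.
  have : (y ^+ 2 - y) ^+ 2 / (2 * 12) <= 6.
    have q0 : 0 <= y ^+ 2 - y by nra.
    have q12 : y ^+ 2 - y <= 12 by nra.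
    nra.
  move=> /(ler_wpM2r A0) le3.
  lra.
have le1 := hypot_ler ((y - 1) * T) (kt 3 ltac:(lra)).
have le2 := hypot_ler (y ^+ 2 * T) (kt 16 ltac:(lra)).
have ge1 := ler_hypot_second_order (y * T) (kt 4 ltac:(lra)).
have ge2 := ler_hypot_second_order ((y ^+ 2 - 1) * T) (kt 15 ltac:(lra)).
rewrite !quoE // in le1 le2 ge1 ge2.
have err k q : 0 < k -> (q * A) ^+ 2 / (2 * (k * t)) =
    q ^+ 2 / (2 * k) * (A * (A / t)).
  by move=> k0; field; rewrite !gt_eqF.
rewrite !err // in ge1 ge2.
have B0 : 0 <= A * (A / t) by exact: mulr_ge0 A0 (divr_ge0 A0 (ltW t0)).
have K1 : (y ^+ 2 / (2 * 4)) ^+ 2 / (2 * 4) <= 1.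
  by move/andP: z1 => []; set z := y ^+ 2; nra.
have K2 : ((y ^+ 2 - 1) ^+ 2 / (2 * 15)) ^+ 2 / (2 * 15) <= 2.
  have : (y ^+ 2 - 1) ^+ 2 <= 225 by move/andP: z1 => []; set z := y ^+ 2; nra.
  by have := sqr_ge0 (y ^+ 2 - 1); set w := (_ - _) ^+ 2; nra.
move: K1 K2 => /(ler_wpM2r B0) K1 /(ler_wpM2r B0) K2.
rewrite /gap; lra.
Qed.

End FourPoints.

Lemma powR_eventually_ge (R : realType) (b M : R) : 0 < b ->
  exists t0, forall t, t0 <= t -> M <= t `^ b.
Proof.
move=> b0; pose m := Num.max M 0.
have m0 : 0 <= m by rewrite le_max lexx orbT.
exists (m `^ b^-1) => t mt.
have Mm : M <= m by rewrite le_max lexx.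
apply: le_trans Mm _; rewrite -[leLHS]powRr1 // -(mulVf (lt0r_neq0 b0)) powRrM.
by rewrite ge0_ler_powR ?nnegrE ?powR_ge0 ?(ltW b0) // (le_trans _ mt) ?powR_ge0.
Qed.

Lemma gt1_ltr_powR (R : realType) (a : R) : 1 < a ->
  {homo powR a : r s / r < s}.
Proof.
move=> a1 r s rs; have a0 : 0 < a by lra.
by rewrite /powR gt_eqF // ltr_expR ltr_pM2r // ln_gt0.
Qed.

Theorem proposition3p3 (R : realType) (alpha : R) (halpha : 1 / 2 < alpha < 1) :
  ~ gromov_hyperbolic (half_line alpha).
Proof.
move=> [delta delta0 hyp]; have /andP[a_gt a_lt] := halpha.
pose y : R := 4 `^ alpha.
have y14 : 1 < y < 4.
  have four0 : (0 : R) <= 4 by lra.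
  rewrite -[ltLHS](powRr0 4) -[X in y < X](powRr1 four0).
  by apply/andP; split; apply: gt1_ltr_powR; lra.
have c0 := gap_gt0 y14; have c4 := gap_le4 y14; set c := gap y in c0 c4.
have b1 : 0 < 2 * alpha - 1 by lra.
have b2 : 0 < 2 - 2 * alpha by lra.
(* The first bound makes the first-order gap [A * c / 2] exceed [2 * delta]
   even when halved; the second makes the relative error [3 * (A / t)] at most
   half of [c / 2]. *)
have [t1 t1P] := powR_eventually_ge (8 * (delta + 1) / c) b1.
have [t2 t2P] := powR_eventually_ge (12 / c) b2.
pose t := Num.max 1 (Num.max t1 t2).
have t_ge1 : 1 <= t by rewrite le_max lexx.
have t0 : 0 < t by lra.
have tn0 : t != 0 by rewrite gt_eqF.
have /t1P : t1 <= t by rewrite !le_max lexx orbT.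
have /t2P : t2 <= t by rewrite !le_max lexx !orbT.
pose T := t `^ alpha; pose A := T ^+ 2 / t.
have T2E : T ^+ 2 = t `^ (2 * alpha).
  by rewrite /T -powR_mulrn ?powR_ge0 // -powRrM mulrC.
have -> : t `^ (2 * alpha - 1) = A.
  by rewrite /A T2E powRB ?tn0 ?implybT // powRr1 // ltW.
have -> : t `^ (2 - 2 * alpha) = t / A.
  rewrite powRB ?tn0 ?implybT // -T2E (powR_mulrn 2 (ltW t0)) /A.
  by field; rewrite tn0 gt_eqF // powR_gt0.
have A0 : 0 < A by rewrite divr_gt0 // exprn_gt0 // powR_gt0.
move=> tA AM.
have {}AM : 8 * (delta + 1) <= A * c by rewrite -ler_pdivrMr.
have {}tA : 12 * (A / t) <= c.
  rewrite mulrA ler_pdivrMr //.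
  by move: tA; rewrite ler_pdivrMr // mulrAC ler_pdivlMr // [t * c]mulrC.
have pt (x : R) : 0 <= x -> x \in `[0, +oo[ by rewrite in_itv /= andbT.
pose P (x : R) (x0 : 0 <= x) : half_line alpha := exist _ x (pt x x0).
have h4 : 0 <= 4 * t by lra.
have h16 : 0 <= 16 * t by lra.
have := hyp (P 0 (lexx 0)) (P _ h4) (P t (ltW t0)) (P _ h16).
rewrite !half_line_mdistE /=.
have -> : (0 : R) `^ alpha = 0 by rewrite powR0 // gt_eqF //; lra.
have y4t : (4 * t) `^ alpha = y * T by rewrite powRM ?ltW.
have y16t : (16 * t) `^ alpha = y ^+ 2 * T.
  rewrite (_ : 16 * t = 4 * (4 * t)); last by ring.
  by rewrite powRM // y4t mulrA -expr2.
rewrite -/T y4t y16t.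
have [] := four_point_excess T t0 y14.
rewrite -/A -/c /=; set d1 := Num.sqrt _; set d2 := Num.sqrt _; set d3 := Num.sqrt _.
set d4 := Num.sqrt _ => ex1; set d5 := Num.sqrt _; set d6 := Num.sqrt _ => ex2.
have A3 : 3 * A <= t.
  have : 3 * (A / t) <= 1 by lra.
  by rewrite mulrA ler_pdivrMr // mul1r.
(* The two alternatives of the maximum are excluded by the two parts of the
   excess estimate: [6 * t - 7 * A] and [A * (c / 4)] both exceed [2 * delta]. *)
have ex3 : A * (c / 4) <= A * (c / 2 - 3 * (A / t)).
  by rewrite ler_pM2l //; lra.
have Ac : A * c <= A * 4 by rewrite ler_pM2l.
rewrite -lerBlDr le_max => /orP[]; lra.
Qed.
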